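(* Let $(M,d)$ be a compact metric space, let $\mu$ be a Borel probability measure on $M$, and let $k:M\times M\to[0,\infty)$ satisfy $k(p,q)=k(q,p)$ for all $p,q\in M$ and, for some $L>0$, $|k(p,s)-k(q,s)|\le L\,d(p,q)$ for all $p,q,s\in M$. Fix $b>0$. For Borel measurable $f\ge 0$ with $\int_M f\,d\mu=1$ define $$U[f](p)=\int_M k(p,q)f(q)\,d\mu(q),\qquad \mathcal{E}_b[f]=\int_M\Big\{\log f+\frac b2 U[f]\Big\}f\,d\mu .$$ Then there exists a Borel measurable function $g\ge 0$ with $\int_M g\,d\mu=1$ such that $$\mathcal{E}_b[g]=\min_{f\ge 0,\ \int_M f\,d\mu=1}\mathcal{E}_b[f].$$ Moreover, $g$ is strictly positive, Lipschitz continuous, and solves the Onsager equation $$g=\big(Z_b[g]\big)^{-1}e^{-bU[g]},\qquad Z_b[g]=\int_M e^{-bU[g](p)}\,d\mu(p).$$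
   Context: The convention $0\log 0=0$ is used in the free energy $\mathcal{E}_b$. *)

(* Defs.v *)
From HB Require Import structures.
From mathcomp Require Import all_boot all_order all_algebra.
From mathcomp Require Import all_classical all_reals all_analysis.
Set Implicit Arguments. Unset Strict Implicit. Unset Printing Implicit Defensive.
Import Order.TTheory GRing.Theory Num.Theory.
Import numFieldNormedType.Exports.
Local Open Scope classical_set_scope.
Local Open Scope ring_scope.

(* Nonempty (pointed) metric spaces; nonemptiness is forced anyway by the
   existence of a probability measure on M. *)
#[short(type="pmetricType")]
HB.structure Definition PointedMetric (K : numDomainType) :=
  { M of Metric K M & isPointed M }.

Notation borel_of M := (g_sigma_algebraType (@open M)).

Definition xlogx (R : realType) (x : R) : R := if x == 0 then 0 else x * ln x.

Definition is_density (R : realType) (M : pmetricType R)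
  (P : probability (borel_of M) R) (f : borel_of M -> R) : Prop :=
  measurable_fun setT f /\ (forall p, 0 <= f p) /\ (\int[P]_p (f p)%:E = 1)%E.

Definition Upot (R : realType) (M : pmetricType R)
  (P : probability (borel_of M) R) (k : M -> M -> R) (f : borel_of M -> R)
  (p : M) : R :=
  fine (\int[P]_q (k p q * f q)%:E)%E.

Definition energy (R : realType) (M : pmetricType R)
  (P : probability (borel_of M) R) (k : M -> M -> R) (b : R)
  (f : borel_of M -> R) : \bar R :=
  (\int[P]_p (xlogx (f p) + b / 2 * Upot P k f p * f p)%:E)%E.

Definition Zpart (R : realType) (M : pmetricType R)
  (P : probability (borel_of M) R) (k : M -> M -> R) (b : R)
  (g : borel_of M -> R) : R :=
  fine (\int[P]_p (expR (- b * Upot P k g p))%:E)%E.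

(* Main.v *)
(* No convexity is available, since [k] need not be positive definite, so we do
   not use weak compactness.  Let [m] be the infimum of the energy and let [f]
   satisfy [E f <= m + t^2].  Comparing [f] with [(1 - t) f + t h], where [h] is
   the Gibbs density proportional to [exp (- b U f)], shows that the relative
   entropy of [f] with respect to [h] is [O(t)], hence that [f] is close to [h]
   in [L^1].  The potentials [U f] are uniformly bounded and equi-Lipschitz, so
   those of almost minimizers accumulate uniformly at some [u]; then [h], and
   with it [f], is [L^1]-close to the Gibbs density [g] of [u].  Since [U] is
   [L^1]-continuous, [u = U g], which is the Onsager equation, and the energy of
   [g] is at most [m] because the entropy of [f] is at least [int f ln g]. *)
Require Import Defs.
From HB Require Import structures.
From mathcomp Require Import all_boot all_order all_algebra.
From mathcomp Require Import all_classical all_reals all_analysis.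
From mathcomp Require Import measurable_realfun ring lra.
Import Order.TTheory GRing.Theory Num.Theory.
Import numFieldNormedType.Exports.
Local Open Scope classical_set_scope.
Local Open Scope ring_scope.
Set Implicit Arguments. Unset Strict Implicit. Unset Printing Implicit Defensive.

(** * Elementary inequalities for [x ln x] and the exponential *)

Section real_inequalities.
Context {R : realType}.
Implicit Types a c s x t l C : R.

Lemma ln_le_subr1 x : 0 < x -> ln x <= x - 1.
Proof.
move=> x0; rewrite lerBrDl; apply: le_trans (expR_ge1Dx _) _.
by rewrite lnK.
Qed.

Lemma xlogx_gt0 x : 0 < x -> xlogx x = x * ln x.
Proof. by move=> x0; rewrite /xlogx gt_eqF. Qed.

(* The left-hand side is the tangent line of [x ln x] at [s]. *)
Lemma xlogx_tangent a s : 0 <= a -> 0 < s -> a * ln s + a - s <= xlogx a.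
Proof.
move=> a0 s0; rewrite /xlogx; case: eqVneq => [->|an0].
  by rewrite mul0r !add0r oppr_le0 ltW.
have {an0}a0 : 0 < a by rewrite lt_neqAle eq_sym an0.
have := @ln_le_subr1 (s / a) (divr_gt0 s0 a0).
rewrite ln_div ?posrE// => /(ler_wpM2l (ltW a0)).
rewrite mulrBr [a * (_ / _ - _)]mulrBr mulr1 mulrCA divff ?gt_eqF// mulr1.
by lra.
Qed.

Lemma xlogx_ge_subr1 a : 0 <= a -> a - 1 <= xlogx a.
Proof. by move=> /xlogx_tangent/(_ ltr01); rewrite ln1 mulr0 add0r. Qed.

(** The tangent line at the mixture [s] lies below [xlogx] at both [a] and [c], and the weighted sum
    of its two values is exactly [s * ln s]. Positivity of [c] makes [s] positive even when
    [a = 0]. *)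
Lemma xlogx_convex a c t : 0 <= a -> 0 < c -> 0 < t -> t <= 1 ->
  xlogx ((1 - t) * a + t * c) <= (1 - t) * xlogx a + t * xlogx c.
Proof.
move=> a0 c0 t0 t1; set s := _ + _.
have s0 : 0 < s by rewrite ltr_wpDl ?mulr_ge0 ?mulr_gt0 ?subr_ge0.
have Ha : (1 - t) * (a * ln s + a - s) <= (1 - t) * xlogx a.
  by rewrite ler_wpM2l ?subr_ge0// xlogx_tangent.
have Hc : t * (c * ln s + c - s) <= t * xlogx c.
  by rewrite ler_wpM2l ?(ltW t0)// xlogx_tangent// ltW.
rewrite (xlogx_gt0 s0).
have -> : s * ln s = (1 - t) * (a * ln s + a - s) + t * (c * ln s + c - s).
  by rewrite /s; ring.
exact: lerD.
Qed.

(* Tangent line of [x ln x] at [c / (1 - x)]. *)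
Lemma xlogx_relative a c x : 0 <= a -> 0 < c -> x <= 2^-1 ->
  x * (a - c) <= xlogx a - a * ln c - a + c + 2 * x ^+ 2 * c.
Proof.
move=> a0 c0 x2.
have x1 : 0 < 1 - x by lra.
have := @xlogx_tangent a (c / (1 - x)) a0 (divr_gt0 c0 x1).
rewrite ln_div ?posrE//.
have : a * ln (1 - x) <= a * (- x).
  by rewrite ler_wpM2l// (le_trans (ln_le_subr1 x1))//; lra.
have : c / (1 - x) <= c + c * (x + 2 * x ^+ 2).
  rewrite ler_pdivrMr// -subr_ge0.
  have -> : (c + c * (x + 2 * x ^+ 2)) * (1 - x) - c = c * (x ^+ 2 * (1 - 2 * x)).
    by ring.
  by rewrite mulr_ge0 ?(ltW c0)// mulr_ge0 ?sqr_ge0//; lra.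
by lra.
Qed.

(** Take [x = l] or [x = - l] in [xlogx_relative], according to the sign of [a - c]. Between
    densities [a] and [c] this is the pointwise form of a Pinsker-type bound. *)
Lemma xlogx_relative_norm a c l : 0 <= a -> 0 < c -> 0 <= l -> l <= 2^-1 ->
  l * `|a - c| <= xlogx a - a * ln c - a + c + 2 * l ^+ 2 * c.
Proof.
move=> a0 c0 l0 l2; have [h|h] := leP 0 (a - c).
  by rewrite ger0_norm//; exact: xlogx_relative.
have := @xlogx_relative a c (- l) a0 c0.
by rewrite ltr0_norm// sqrrN mulNr mulrN; apply; lra.
Qed.

Lemma expR_sub1_le x : x <= 2^-1 -> 0 <= x -> expR x - 1 <= 2 * x.
Proof.
move=> x2 x0; have x1 : 0 < 1 - x by lra.
have : expR x <= (1 - x)^-1.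
  rewrite -[x in expR x]opprK expRN lef_pV2 ?posrE ?expR_gt0//.
  exact: expR_ge1Dx.
have : (1 - x)^-1 <= 1 + 2 * x.
  by rewrite -div1r ler_pdivrMr//; nra.
by lra.
Qed.

(** For [x <= t] the difference is [expR (- x) * (1 - expR (x - t))], whose first factor is at most
    [1] and whose second is at most [t - x]. *)
Lemma expRN_Lipschitz x t : 0 <= x -> 0 <= t ->
  `|expR (- x) - expR (- t)| <= `|x - t|.
Proof.
wlog xt : x t / x <= t => [H|x0 t0].
  have [xt|/ltW tx] := leP x t; first exact: H.
  by move=> x0 t0; rewrite distrC [`|x - t|]distrC; exact: H.
rewrite ger0_norm ?subr_ge0 ?ler_expR ?lerN2// ler0_norm ?subr_le0// opprB.
have := expR_ge1Dx (x - t).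
have -> : expR (- t) = expR (- x) * expR (x - t) by rewrite -expRD; congr expR; ring.
have : expR (- x) <= 1 by rewrite -expR0 ler_expR oppr_le0.
have : 0 <= expR (- x) by exact: expR_ge0.
have : expR (x - t) <= 1 by rewrite -expR0 ler_expR subr_le0.
by nra.
Qed.

(** Lets an error parameter tend to zero. If [x] were positive, an [l] with [C * l <= x / 2] would
    give a contradiction. *)
Lemma small_multiple_le0 x C l0 : 0 < l0 ->
  (forall l, 0 < l -> l <= l0 -> x <= C * l) -> x <= 0.
Proof.
move=> l00 h; rewrite leNgt; apply/negP => x0.
have C0 : 0 < `|C| + 1 by rewrite ltr_wpDl.
pose l := Order.min l0 (x / (2 * (`|C| + 1))).
have l_gt0 : 0 < l by rewrite lt_min l00 divr_gt0// mulr_gt0.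
have : l <= x / (2 * (`|C| + 1)) by rewrite ge_min lexx orbT.
rewrite ler_pdivlMr ?mulr_gt0// => lx.
have := h l l_gt0; rewrite ge_min lexx => /(_ isT).
have : C * l <= `|C| * l by rewrite ler_pM2r// ler_norm.
nra.
Qed.

Lemma measurable_xlogx : measurable_fun [set: R] (@xlogx R).
Proof.
rewrite (_ : @xlogx R = fun x => x * ln x).
  by apply: measurable_funM => //; exact: measurable_ln.
by apply/funext => x; rewrite /xlogx; case: eqVneq => // ->; rewrite mul0r.
Qed.

End real_inequalities.

(** * Lipschitz functions on a compact metric space *)

Section compact_metric.
Context {R : realType} {M : pmetricType R}.
Hypothesis hM : compact [set: M].
Implicit Types (L K e : R) (u v : M -> R).

Definition Lip L u := forall p q, `|u p - u q| <= L * mdist p q.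

Lemma compact_net e : 0 < e ->
  exists s : seq M, forall p, exists2 x, x \in s & mdist x p < e.
Proof.
move=> e0; move: hM; rewrite compact_cover => /(_ M setT (fun x => (ball x e)^°)).
case=> [x _|p _|D _ hD]; first exact: open_interior.
  by exists p => //; exact: nbhsx_ballx.
have /finite_seqP[s Ds] := finite_fset D.
exists s => p; have [x xD /interior_subset] := hD p I.
rewrite ballEmdist; exists x => //.
by have : [set` s] x by rewrite -Ds.
Qed.

Lemma Lip_measurable L u : Lip L u -> measurable_fun [set: borel_of M] u.
Proof.
move=> uL.
have cu : continuous u.
  move=> p; apply/cvgrPdist_lt => /= e e0.
  (* [L] has no prescribed sign here, so [|L| + 1] serves as a positive Lipschitz constant. *)
  have L0 : 0 < `|L| + 1 by rewrite ltr_wpDl.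
  have : nbhs p (ball p (e / (`|L| + 1))) by apply: nbhsx_ballx; exact: divr_gt0.
  apply: filterS => q; rewrite ballEmdist /= ltr_pdivlMr// => pq.
  apply: le_lt_trans (uL p q) _; apply: le_lt_trans pq.
  rewrite mulrC ler_wpM2l ?mdist_ge0//.
  by rewrite (le_trans (ler_norm L))// lerDl.
apply: (measurability (@RGenOpens.G R)).
  exact: RGenOpens.measurableE.
move=> _ [_ [a [b ->]] <-]; rewrite setTI.
apply: sub_sigma_algebra; apply: open_comp; last exact: interval_open.
by move=> x _; exact: cu.
Qed.

(* An ultrafilter containing all the sets [V e] selects the limit, pointwise by
   compactness of [[0, K]], and uniformly by equi-Lipschitz continuity. *)
Lemma Lip_cluster (V : R -> set (M -> R)) L K :
  0 < L ->
  (forall e, 0 < e -> V e !=set0) ->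
  (forall e e', e <= e' -> V e `<=` V e') ->
  (forall e v, V e v -> Lip L v) ->
  (forall e v, V e v -> forall p, 0 <= v p <= K) ->
  exists u, [/\ Lip L u, forall p, 0 <= u p <= K &
    forall e, 0 < e -> exists2 v, V e v & forall p, `|v p - u p| <= e].
Proof.
move=> L0 Vn0 Vmon VL VK.
pose F := filter_from [set e : R | 0 < e] V.
have FF : Filter F.
  apply: filter_from_filter; first by exists 1 => /=.
  move=> i j /= i0 j0; exists (Order.min i j); first by rewrite /= lt_min i0.
  by move=> v Vv; split; apply: Vmon Vv; rewrite ge_min lexx ?orbT.
have FP : ProperFilter F by apply: filter_from_proper => // e /= /Vn0.
have [G [GU FG]] := ultraFilterLemma FP.
have GV e : 0 < e -> G (V e) by move=> e0; apply: FG; exists e.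
have lim p : exists2 y, 0 <= y <= K &
    forall e, 0 < e -> G [set v | `|v p - y| < e].
  have GP : ProperFilter ((fun v : M -> R => v p) @ G) by exact: fmap_proper_filter.
  have [|y [yK cl]] := @segment_compact _ 0 K _ GP.
  - have : G [set v | v p \in `[0, K]]; last exact.
    by apply: filterS (GV 1 ltr01) => v Vv; rewrite /= in_itv/=; exact: VK Vv _.
  - exists y; first by move: yK; rewrite /= in_itv.
    (* A cluster point of an ultrafilter is a limit: otherwise the complement would belong to [G]
       and so would have to meet the ball of radius [e] about [y] in its values at [p]. *)
    move=> e e0; have [//|GC] := in_ultra_setVsetC [set v | `|v p - y| < e] GU.
    have [z [/= + yz]] := cl [set z | ~ `|z - y| < e] (ball y e) GC (nbhsx_ballx y e e0).
    by rewrite distrC; move: yz; rewrite /ball /= => ->.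
pose u p := projT1 (cid2 (lim p)).
have uK p : 0 <= u p <= K by rewrite /u; case: cid2.
have ulim p e : 0 < e -> G [set v | `|v p - u p| < e].
  by rewrite /u; case: cid2 => y /= _; exact.
have uL : Lip L u.
  move=> p q; apply/ler_addgt0Pr => e e0.
  have e2 : 0 < e / 2 by exact: divr_gt0.
  have GI : G ([set v | `|v p - u p| < e / 2] `&` [set v | `|v q - u q| < e / 2]
      `&` V 1).
    by apply: filterI; [apply: filterI; exact: ulim|exact: GV].
  have [v [[/= vp vq] Vv]] := filter_ex GI.
  have := VL _ _ Vv p q.
  have -> : u p - u q = - (v p - u p) + (v q - u q) + (v p - v q) by ring.
  move=> vpq; apply: le_trans (ler_normD _ _) _.
  have := ler_normD (- (v p - u p)) (v q - u q); rewrite normrN => h.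
  by lra.
exists u; split => // e e0.
(* Passing from [p] to a net point costs at most [L * d] for each of [v] and [u], and the error at
   the net point is at most [d]; the sum stays below [e]. *)
pose d := e / (2 * (L + 1)).
have d0 : 0 < d by rewrite divr_gt0// mulr_gt0// addr_gt0.
have [s hs] := compact_net d0.
have Gs : G [set v | forall x, x \in s -> `|v x - u x| < d].
  elim: s {hs} => [|x s ih]; first by apply: filterS filterT.
  apply: filterS (filterI (ulim x d d0) ih) => v [/= vx vs] y.
  by rewrite inE => /predU1P[->//|]; exact: vs.
have [v [/= vs Vv]] := filter_ex (filterI Gs (GV _ e0)).
exists v => // p; have [x xs xp] := hs p.
have := VL _ _ Vv x p; have := uL x p; have := vs x xs.
have -> : v p - u p = - (v x - v p) + (v x - u x) + (u x - u p) by ring.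
have := ler_normD (- (v x - v p)) (v x - u x); rewrite normrN.
have := ler_normD (- (v x - v p) + (v x - u x)) (u x - u p).
have : L * mdist x p <= L * d by rewrite ler_wpM2l// ltW.
have : 2 * (L * d) + 2 * d = e.
  by rewrite /d; field; rewrite gt_eqF// addr_gt0.
by lra.
Qed.

End compact_metric.

(** * Integration of real functions against a probability measure *)

Section probability_integral.
Context {d : measure_display} {T : measurableType d} {R : realType}.
Variable P : probability T R.
Implicit Types (f g u : T -> R) (c K : R).

Definition integ f := P.-integrable setT (EFin \o f).

Lemma integ_measurable f : integ f -> measurable_fun setT f.
Proof. by move=> /integrableP[/measurable_EFinP]. Qed.

Lemma integD f g : integ f -> integ g -> integ (fun x => f x + g x).
Proof. by move=> fi gi; exact: (integrableD measurableT fi gi). Qed.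

Lemma integB f g : integ f -> integ g -> integ (fun x => f x - g x).
Proof. by move=> fi gi; exact: (integrableB measurableT fi gi). Qed.

Lemma integZ c f : integ f -> integ (fun x => c * f x).
Proof. by move=> fi; exact: (integrableZl measurableT c fi). Qed.

Lemma integ_cst c : integ (fun=> c).
Proof. exact: (finite_measure_integrable_cst P c measurableT). Qed.

Lemma integ_norm f : integ f -> integ (fun x => `|f x|).
Proof. exact: integrable_norm. Qed.

Lemma integ_le f g : measurable_fun setT f -> (forall x, `|f x| <= g x) ->
  integ g -> integ f.
Proof.
move=> mf fg; apply: le_integrable => //; first exact/measurable_EFinP.
by move=> x _; rewrite /= lee_fin (le_trans (fg x))// ler_norm.
Qed.

Lemma integM u f K : measurable_fun setT u -> (forall x, `|u x| <= K) ->
  integ f -> integ (fun x => u x * f x).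
Proof.
move=> mu uK fi; apply: (@integ_le _ (fun x => K * `|f x|)).
- exact/measurable_funM/integ_measurable.
- by move=> x; rewrite normrM ler_wpM2r.
- exact/integZ/integ_norm.
Qed.

Lemma integ_bounded u K : measurable_fun setT u -> (forall x, `|u x| <= K) ->
  integ u.
Proof. by move=> mu uK; exact: (integ_le mu uK (integ_cst K)). Qed.

Lemma IntD f g : integ f -> integ g ->
  (\int[P]_x (f x + g x) = \int[P]_x f x + \int[P]_x g x)%R.
Proof. by move=> fi gi; rewrite RintegralD. Qed.

Lemma IntB f g : integ f -> integ g ->
  (\int[P]_x (f x - g x) = \int[P]_x f x - \int[P]_x g x)%R.
Proof. by move=> fi gi; rewrite RintegralB. Qed.

Lemma IntZ c f : integ f -> (\int[P]_x (c * f x) = c * \int[P]_x f x)%R.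
Proof. by move=> fi; rewrite RintegralZl. Qed.

Lemma Int_cst c : (\int[P]_x c = c)%R.
Proof. by rewrite Rintegral_cst// [X in fine X]probability_setT mulr1. Qed.

Lemma Int_le f g : integ f -> integ g -> (forall x, f x <= g x) ->
  (\int[P]_x f x <= \int[P]_x g x)%R.
Proof. by move=> fi gi fg; apply: le_Rintegral. Qed.

Lemma Int_eq f g : f =1 g -> (\int[P]_x f x = \int[P]_x g x)%R.
Proof. by move=> fg; apply: eq_Rintegral => x _; exact: fg. Qed.

Lemma IntE f : integ f -> (\int[P]_x (f x)%:E)%E = (\int[P]_x f x)%R%:E.
Proof. by move=> fi; rewrite fineK//; exact: integrable_fin_num fi. Qed.

Lemma Int_normM_le u f K : measurable_fun setT u -> (forall x, `|u x| <= K) ->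
  integ f -> `|\int[P]_x (u x * f x)|%R <= K * (\int[P]_x `|f x|)%R.
Proof.
move=> mu uK fi; have ufi := integM mu uK fi.
apply: le_trans (le_normr_Rintegral _ ufi) _ => //.
rewrite -IntZ; last exact: integ_norm.
apply: Int_le; [exact: integ_norm|exact/integZ/integ_norm|] => x.
by rewrite normrM ler_wpM2r.
Qed.

(** The negative part is bounded, hence integrable for a probability, so an infinite integral of the
    positive part would make the whole integral [+oo]. *)
Lemma integ_bounded_below f c : measurable_fun setT f -> (forall x, - c <= f x) ->
  (\int[P]_x (f x)%:E < +oo)%E -> integ f.
Proof.
move=> mf fc foo.
have mfp : measurable_fun setT f^\+ by exact: measurable_funrpos.
have mfm : measurable_fun setT f^\- by exact: measurable_funrneg.
have fmi : integ f^\-.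
  apply: (@integ_bounded _ `|c|) => // x.
  rewrite ger0_norm ?funrneg_ge0// /funrneg ge_max normr_ge0 andbT.
  by rewrite (le_trans _ (ler_norm c))// lerNl.
have fpi : integ f^\+.
  apply/integrableP; split; first exact/measurable_EFinP.
  under eq_integral do rewrite /= ger0_norm ?funrpos_ge0//.
  rewrite ltNge leye_eq; apply/negP => /eqP fpoo.
  move: foo; rewrite integralE.
  have -> : (fun x => (f x)%:E)^\+%E = EFin \o f^\+ by exact: funerpos.
  have -> : (fun x => (f x)%:E)^\-%E = EFin \o f^\- by exact: funerneg.
  by rewrite fpoo (IntE fmi).
apply: integ_le mf _ (integD fpi fmi) => x.
by rewrite -[X in _ <= X]/((f^\+ + f^\-) x) funrposDneg.
Qed.

End probability_integral.

(** * Boundedness and joint measurability of the kernel *)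

Section kernel.
Context {R : realType} {M : pmetricType R}.
Variables (k : M -> M -> R) (L : R).
Hypothesis hM : compact [set: M].
Hypothesis hk0 : forall p q, 0 <= k p q.
Hypothesis hksym : forall p q, k p q = k q p.
Hypothesis hL : 0 < L.
Hypothesis hkL : forall s, Lip L (k^~ s).

(** Moving each argument to a point of a finite net of radius [1] costs at most [L]. The sum over
    all pairs of net points dominates each of its terms because [k] is nonnegative. *)
Lemma kernel_bounded : exists2 K : R, 0 <= K & forall p q, k p q <= K.
Proof.
have [s hs] := compact_net hM ltr01.
exists (\sum_(x <- s) \sum_(y <- s) k x y + 2 * L).
  by rewrite addr_ge0 ?mulr_ge0 ?(ltW hL)//; do 2 (apply: sumr_ge0 => ? _).
have near p : exists2 x, x \in s & forall q, k p q <= k x q + L.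
  have [x xs xp] := hs p; exists x => // q.
  have := hkL q x p; rewrite ler_distlC => /andP[_]; move/le_trans; apply.
  by rewrite lerD2l ger_pMr// ltW.
move=> p q; have [x xs px] := near p; have [y ys qy] := near q.
have kxy : k x y <= \sum_(x <- s) \sum_(y <- s) k x y.
  rewrite (big_rem x)//= (big_rem y)//= -addrA lerDl.
  by rewrite addr_ge0//; [apply: sumr_ge0|apply: sumr_ge0 => ? _; apply: sumr_ge0].
have := px q; have := qy x; rewrite [k q x]hksym [k y x]hksym; lra.
Qed.

Lemma kernel_measurable p : measurable_fun [set: borel_of M] (k p).
Proof.
by apply: (@Lip_measurable _ _ L) => q r; rewrite ![k p _]hksym; exact: hkL.
Qed.

(* [k p q] is the infimum of [k x q + L d(x, p)] over a countable dense set of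
   [x], and these functions have separated variables. *)
Lemma kernel_jointly_measurable :
  measurable_fun [set: borel_of M * borel_of M] (fun z => k z.1 z.2).
Proof.
(* At this radius [k x q + L * mdist x p] exceeds [k p q] by at most [2 * L * mdist x p], which is
   less than [n.+1%:R^-1]. *)
have en n : 0 < (2 * L)^-1 * (n.+1%:R^-1 : R).
  by rewrite mulr_gt0 ?invr_gt0 ?mulr_gt0 ?ltr0Sn.
pose s n := projT1 (cid (compact_net hM (en n))).
have hs n p : exists2 x, x \in s n & mdist x p < (2 * L)^-1 * n.+1%:R^-1.
  by rewrite /s; case: cid.
apply: (measurability (@RGenInftyO.G R)); first exact: RGenInftyO.measurableE.
move=> _ [_ [c ->] <-]; rewrite setTI.
have -> : (fun z : borel_of M * borel_of M => k z.1 z.2) @^-1` `]-oo, c[%classic =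
    \bigcup_n \bigcup_(x in [set` s n])
      [set z : borel_of M * borel_of M | k x z.2 + L * mdist x z.1 < c].
  apply/seteqP; split => -[p q] /=; rewrite in_itv/=.
    move=> kc; have [n knc] := ltr_add_invr kc.
    exists n => //; have [x xs xp] := hs n p; exists x => //=.
    apply: le_lt_trans knc.
    have := hkL q x p; rewrite /= ler_distl => /andP[_].
    have : L * mdist x p <= L * ((2 * L)^-1 * n.+1%:R^-1).
      by rewrite ler_pM2l// ltW.
    have -> : L * ((2 * L)^-1 * n.+1%:R^-1) = 2^-1 * n.+1%:R^-1.
      by rewrite mulrA invfM mulrCA divff ?gt_eqF// mulr1.
    by move: n.+1%:R^-1 (L * mdist x p) => y a; lra.
  move=> [n _ [x /= xs]]; apply: le_lt_trans.
  have := hkL q x p; rewrite ler_distlC => /andP[_]; lra.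
apply: bigcup_measurable => n _; apply: fin_bigcup_measurable => // x _.
have mf : measurable_fun [set: borel_of M * borel_of M]
    (fun z => k x z.2 + L * mdist x z.1).
  apply: measurable_funD.
    exact: (measurableT_comp (kernel_measurable x) measurable_snd).
  apply: measurable_funM => //.
  have mx : measurable_fun [set: borel_of M] (mdist x).
    apply: (@Lip_measurable _ _ 1) => p q; rewrite mul1r ler_distl.
    have := metric_triangle x p q; have := metric_triangle x q p.
    by rewrite (metric_sym q p); lra.
  exact: (measurableT_comp mx measurable_fst).
have := mf measurableT `]-oo, c[%classic (measurable_itv _).
by rewrite setTI; congr measurable; apply/seteqP; split => z /=; rewrite in_itv.
Qed.

End kernel.

(** * Densities, their potentials and their free energy *)

Section free_energy.
Context {R : realType} {M : pmetricType R}.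
Variables (P : probability (borel_of M) R) (k : M -> M -> R) (b L K : R).
Hypothesis hM : compact [set: M].
Hypothesis hk0 : forall p q, 0 <= k p q.
Hypothesis hksym : forall p q, k p q = k q p.
Hypothesis hL : 0 < L.
Hypothesis hkL : forall s, Lip L (k^~ s).
Hypothesis hK0 : 0 <= K.
Hypothesis hkK : forall p q, k p q <= K.
Hypothesis hb : 0 < b.
Local Notation T := (borel_of M).
Implicit Types f h g : T -> R.
Local Notation U := (Upot P k).
Local Notation density := (is_density P).

Lemma density_integ f : density f -> integ P f.
Proof.
move=> [mf [f0 f1]]; apply/integrableP; split; first exact/measurable_EFinP.
under eq_integral do rewrite /= ger0_norm//.
by rewrite f1 ltry.
Qed.

Lemma density_Int f : density f -> (\int[P]_x f x)%R = 1.
Proof. by move=> [_ [_ f1]]; rewrite /Rintegral f1. Qed.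

Lemma kernel_norm p q : `|k p q| <= K.
Proof. by rewrite ger0_norm. Qed.

Lemma kernel_integ p f : integ P f -> integ P (fun q => k p q * f q).
Proof.
exact: (integM (kernel_measurable hksym hkL p) (kernel_norm p)).
Qed.

Lemma Upot_dist f h p : integ P f -> integ P h ->
  `|U f p - U h p| <= K * (\int[P]_q `|f q - h q|)%R.
Proof.
move=> fi hi; rewrite /Upot -IntB; [|exact: kernel_integ..].
under eq_Rintegral do rewrite -mulrBr.
apply: Int_normM_le; [|exact: kernel_norm|exact: integB].
exact: kernel_measurable hksym hkL p.
Qed.

(** The constant is the same for all densities because each has mass one; this is the equicontinuity
    that [Lip_cluster] requires. *)
Lemma Upot_Lip f : density f -> Lip L (U f).
Proof.
move=> fd p q; have fi := density_integ fd.
rewrite /Upot -IntB; [|exact: kernel_integ..].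
under eq_Rintegral do rewrite -mulrBl.
rewrite -[leRHS]mulr1 -(density_Int fd).
under [X in _ <= _ * X]eq_Rintegral do rewrite -[f _]ger0_norm ?fd.2.1//.
apply: Int_normM_le => //; last by move=> s; exact: hkL.
by apply: measurable_funB; exact: kernel_measurable hksym hkL _.
Qed.

Lemma Upot_measurable f : density f -> measurable_fun [set: T] (U f).
Proof. by move=> /Upot_Lip; exact: Lip_measurable. Qed.

Lemma Upot_bound f p : density f -> 0 <= U f p <= K.
Proof.
move=> fd; have f0 := fd.2.1; apply/andP; split.
  by apply: Rintegral_ge0 => q _; rewrite mulr_ge0.
rewrite -[leRHS]mulr1 -(density_Int fd) -IntZ; last exact: density_integ.
apply: Int_le; [exact/kernel_integ/density_integ|exact/integZ/density_integ|].
by move=> q; rewrite ler_wpM2r.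
Qed.

Lemma Upot_norm f : density f -> forall p, `|U f p| <= K.
Proof. by move=> fd p; have /andP[? ?] := Upot_bound p fd; rewrite ger0_norm. Qed.

Lemma Upot_integ f h : density f -> integ P h -> integ P (fun p => U f p * h p).
Proof.
by move=> fd; exact: (integM (Upot_measurable fd) (Upot_norm fd)).
Qed.

(** Tonelli exchanges the two integrations of a nonnegative integrand, and the symmetry of [k]
    restores its form. *)
Lemma Upot_sym f h : density f -> density h ->
  (\int[P]_p (U f p * h p) = \int[P]_p (U h p * f p))%R.
Proof.
move=> fd hd; rewrite /Rintegral.
have UE g p : density g -> (U g p)%:E = (\int[P]_q (k p q * g q)%:E)%E.
  by move=> gd; rewrite [RHS]IntE//; exact/kernel_integ/density_integ.
have step g g' : density g -> density g' -> (\int[P]_p (U g p * g' p)%:E =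
    \int[P]_p \int[P]_q (k p q * g q * g' p)%:E)%E.
  move=> gd gd'; apply: eq_integral => p _.
  rewrite EFinM UE// -ge0_integralZr//.
  - apply: measurableT_comp => //.
    exact: integ_measurable (kernel_integ _ (density_integ gd)).
  - by move=> q _; rewrite lee_fin mulr_ge0// gd.2.1.
  - by rewrite lee_fin gd'.2.1.
congr fine; rewrite !step//.
rewrite (@fubini_tonelli _ _ _ _ _ P P (fun z => (k z.1 z.2 * f z.2 * h z.1)%:E)).
- apply: eq_integral => p _; apply: eq_integral => q _ /=.
  by rewrite hksym mulrAC.
- apply/measurable_EFinP; apply: measurable_funM; first apply: measurable_funM.
  + exact: kernel_jointly_measurable hM hksym hL hkL.
  + exact: (measurableT_comp fd.1 measurable_snd).
  + exact: (measurableT_comp hd.1 measurable_fst).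
- by move=> z; rewrite lee_fin !mulr_ge0// ?fd.2.1 ?hd.2.1.
Qed.

Definition interaction f h := (\int[P]_p (U f p * h p))%R.
Definition entropy f := (\int[P]_p xlogx (f p))%R.
Definition finite_entropy f := integ P (fun p => xlogx (f p)).
(** The real-valued counterpart of [energy]. It is used together with [finite_entropy], since a
    real-valued integral defaults to [0] when the extended one is infinite. *)
Definition free_energy f := entropy f + b / 2 * interaction f f.

Lemma interaction_bound f h : density f -> density h -> 0 <= interaction f h <= K.
Proof.
move=> fd hd; apply/andP; split.
  apply: Rintegral_ge0 => p _; rewrite mulr_ge0 ?hd.2.1//.
  by case/andP: (Upot_bound p fd).
rewrite -[leRHS]mulr1 -(density_Int hd) -IntZ; last exact: density_integ.
apply: Int_le; [exact/Upot_integ/density_integ|exact/integZ/density_integ|].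
by move=> p; rewrite ler_wpM2r ?hd.2.1//; case/andP: (Upot_bound p fd).
Qed.

Lemma energy_free_energy f : density f -> finite_entropy f ->
  energy P k b f = (free_energy f)%:E.
Proof.
move=> fd fe; rewrite /energy /free_energy /entropy /interaction.
have Ui := Upot_integ fd (density_integ fd).
rewrite -IntZ// -IntD//; last exact: integZ.
rewrite -IntE; last by apply: integD => //; exact: integZ.
by apply: eq_integral => p _; rewrite mulrA.
Qed.

(** The energy integrand is at least [-1], so finite energy makes it integrable; subtracting the
    interaction part, integrable because [U f] is bounded, leaves the entropy. *)
Lemma finite_energy_entropy f : density f -> (energy P k b f < +oo)%E ->
  finite_entropy f.
Proof.
move=> fd foo; have Ui := Upot_integ fd (density_integ fd).
have mx : measurable_fun setT (fun p => xlogx (f p)).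
  exact: (measurableT_comp (@measurable_xlogx R) fd.1).
have Fi : integ P (fun p => xlogx (f p) + b / 2 * U f p * f p).
  apply: (integ_bounded_below (c := 1)) foo.
    apply: measurable_funD => //; apply: measurable_funM; last exact: fd.1.
    by apply: measurable_funM => //; exact: Upot_measurable.
  move=> p; have := xlogx_ge_subr1 (fd.2.1 p); have f0 := fd.2.1 p.
  have : 0 <= b / 2 * U f p * f p.
    rewrite !mulr_ge0 ?invr_ge0 ?(ltW hb)//.
    by case/andP: (Upot_bound p fd).
  lra.
have := integB Fi (integZ (b / 2) Ui).
rewrite /finite_entropy; congr integ; apply/funext => p; ring.
Qed.

Lemma free_energy_ge0 f : density f -> finite_entropy f -> 0 <= free_energy f.
Proof.
move=> fd fe; rewrite addr_ge0//.
  have -> : 0 = (\int[P]_p (f p - 1))%R.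
    rewrite IntB; [|exact: density_integ|exact: integ_cst].
    by rewrite Int_cst density_Int// subrr.
  apply: Int_le => //; first by apply: integB; [exact: density_integ|exact: integ_cst].
  by move=> p; exact/xlogx_ge_subr1/fd.2.1.
rewrite mulr_ge0 ?divr_ge0 ?(ltW hb)//.
by case/andP: (interaction_bound fd fd).
Qed.

(** * Gibbs densities of bounded potentials *)

Implicit Types u v : M -> R.
Local Notation Q := interaction.
Local Notation J := free_energy.

(** A class containing every [U f] and also the uniform limit [u], before [u] is known to be the
    potential of a density. The bounds keep the Boltzmann weights between [expR (- b * K)] and
    [1]. *)
Definition potential u := measurable_fun [set: T] u /\ forall p, 0 <= u p <= K.
Definition partition_fun u := (\int[P]_p expR (- b * u p))%R.
Definition gibbs u : T -> R := fun p => (partition_fun u)^-1 * expR (- b * u p).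

Lemma Upot_potential f : density f -> potential (U f).
Proof.
move=> fd; split; first exact: Upot_measurable.
by move=> p; exact: Upot_bound.
Qed.

Lemma potential_integ u f : potential u -> density f ->
  integ P (fun p => u p * f p).
Proof.
move=> [mu uK] /density_integ; apply: (@integM _ _ _ _ _ _ K) => // p.
by have /andP[? ?] := uK p; rewrite ger0_norm.
Qed.

Lemma boltzmann_bound u p : potential u -> expR (- b * K) <= expR (- b * u p) <= 1.
Proof.
move=> [_ /(_ p)/andP[u0 uK]]; rewrite ler_expR -[X in _ && (_ <= X)](@expR0 R) ler_expR.
by rewrite !mulNr lerN2 ler_pM2l// uK oppr_le0 mulr_ge0// ltW.
Qed.

Lemma boltzmann_integ u : potential u -> integ P (fun p => expR (- b * u p)).
Proof.
move=> up; apply: (@integ_bounded _ _ _ _ _ 1) => [|p].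
  apply: (measurableT_comp (@measurable_expR R)).
  by apply: measurable_funM => //; exact: up.1.
by rewrite ger0_norm ?expR_ge0//; case/andP: (boltzmann_bound p up).
Qed.

Lemma partition_gt0 u : potential u -> 0 < partition_fun u.
Proof.
move=> up; apply: (@lt_le_trans _ _ (expR (- b * K))); first exact: expR_gt0.
rewrite -[leLHS](Int_cst P); apply: Int_le.
- exact: integ_cst.
- exact: boltzmann_integ.
- by move=> p; case/andP: (boltzmann_bound p up).
Qed.

Lemma gibbs_gt0 u p : potential u -> 0 < gibbs u p.
Proof. by move=> up; rewrite mulr_gt0 ?expR_gt0// invr_gt0 partition_gt0. Qed.

Lemma gibbs_density u : potential u -> density (gibbs u).
Proof.
move=> up; have wi := boltzmann_integ up; have gi := integZ (partition_fun u)^-1 wi.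
split; first exact: integ_measurable gi.
split; first by move=> p; exact/ltW/gibbs_gt0.
rewrite [LHS](IntE gi) (IntZ _ wi) mulVf// gt_eqF//; exact: partition_gt0.
Qed.

Lemma ln_gibbs u p : potential u ->
  ln (gibbs u p) = - (b * u p) - ln (partition_fun u).
Proof.
move=> up; rewrite lnM ?posrE ?expR_gt0 ?invr_gt0 ?partition_gt0//.
by rewrite lnV ?posrE ?partition_gt0// expRK addrC mulNr.
Qed.

Lemma cross_integ u f : potential u -> density f ->
  integ P (fun p => f p * ln (gibbs u p)).
Proof.
move=> up fd; have fi := density_integ fd.
have := integB (integZ (- b) (potential_integ up fd)) (integZ (ln (partition_fun u)) fi).
by congr integ; apply/funext => p; rewrite ln_gibbs//; ring.
Qed.

(** Since [ln (gibbs u)] is affine in [u], the cross entropy reduces to a linear term and the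
    logarithm of the partition function. *)
Lemma cross_Int u f : potential u -> density f ->
  (\int[P]_p (f p * ln (gibbs u p)))%R =
  - b * (\int[P]_p (u p * f p))%R - ln (partition_fun u).
Proof.
move=> up fd; have fi := density_integ fd; have ufi := potential_integ up fd.
rewrite -(mulr1 (ln (partition_fun u))) -(density_Int fd) -!IntZ// -IntB; [|exact: integZ..].
by apply: Int_eq => p; rewrite ln_gibbs//; ring.
Qed.

Lemma gibbs_finite_entropy u : potential u -> finite_entropy (gibbs u).
Proof.
move=> up; have := cross_integ up (gibbs_density up); congr integ.
by apply/funext => p; rewrite xlogx_gt0// gibbs_gt0.
Qed.

Lemma entropy_gibbs u : potential u -> entropy (gibbs u) =
  - b * (\int[P]_p (u p * gibbs u p))%R - ln (partition_fun u).
Proof.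
move=> up; rewrite -cross_Int//; last exact: gibbs_density.
by apply: Int_eq => p; rewrite xlogx_gt0// gibbs_gt0.
Qed.

(* A weak form of Pinsker's inequality: the right-hand side is [2 l^2] plus the
   relative entropy of [f] with respect to [gibbs u]. *)
Lemma L1_dist_gibbs u f l : potential u -> density f -> finite_entropy f ->
  0 <= l -> l <= 2^-1 ->
  l * (\int[P]_p `|f p - gibbs u p|)%R <=
  entropy f + b * (\int[P]_p (u p * f p))%R + ln (partition_fun u) + 2 * l ^+ 2.
Proof.
move=> up fd fe l0 l2.
have fi := density_integ fd; have gd := gibbs_density up.
have gi := density_integ gd; have ci := cross_integ up fd.
have i1 := integB fe ci; have i2 := integB i1 fi; have i3 := integD i2 gi.
have i4 := integZ (2 * l ^+ 2) gi.
have ni := integ_norm (integB fi gi).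
have := Int_le (integZ l ni) (integD i3 i4).
rewrite IntZ// => /(_ _)/le_trans; apply.
  by move=> p; apply: xlogx_relative_norm => //; [exact: fd.2.1|exact: gibbs_gt0].
rewrite IntD// IntD// IntB// IntB// IntZ// cross_Int// (density_Int fd) (density_Int gd).
rewrite /entropy; lra.
Qed.

(** Boltzmann weights and partition functions each change by a factor of at most [expR (b * l)], so
    the densities differ by a factor of at most [E]. The difference is then at most [(E - 1)] times
    their sum, and that sum has integral [2]. *)
Lemma gibbs_L1_dist u v l : potential u -> potential v -> 0 <= l ->
  2 * b * l <= 2^-1 -> (forall p, `|u p - v p| <= l) ->
  (\int[P]_p `|gibbs u p - gibbs v p|)%R <= 8 * b * l.
Proof.
move=> up vp l0 bl uv; set E := expR (2 * b * l).
have gu := gibbs_density up; have gv := gibbs_density vp.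
have half u' v' : potential u' -> potential v' -> (forall p, `|u' p - v' p| <= l) ->
    forall p, gibbs u' p <= E * gibbs v' p.
  move=> up' vp' uv' p.
  have w w1 w2 q : (forall p, `|w1 p - w2 p| <= l) ->
      expR (- b * w1 q) <= expR (b * l) * expR (- b * w2 q).
    move=> /(_ q); rewrite ler_distl => /andP[h _].
    by rewrite -expRD ler_expR; move: h; rewrite -(ler_pM2l hb); lra.
  have Z : partition_fun v' <= expR (b * l) * partition_fun u'.
    rewrite -IntZ; last exact: boltzmann_integ.
    apply: Int_le; [exact: boltzmann_integ|exact/integZ/boltzmann_integ|].
    by move=> q; apply: w => r; rewrite distrC.
  have Zi : (partition_fun u')^-1 <= expR (b * l) * (partition_fun v')^-1.
    by rewrite ler_pdivlMr ?partition_gt0// ler_pdivrMl ?partition_gt0// mulrC.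
  have -> : E * gibbs v' p = (expR (b * l) * (partition_fun v')^-1) *
      (expR (b * l) * expR (- b * v' p)).
    by rewrite /gibbs /E mulrACA -expRD; congr (expR _ * _); ring.
  rewrite /gibbs ler_pM ?expR_ge0//; last exact: w.
  by rewrite invr_ge0 ltW// partition_gt0.
have vu p : `|v p - u p| <= l by rewrite distrC.
have E1 : E - 1 <= 4 * b * l.
  have := @expR_sub1_le _ _ bl; rewrite -/E !mulrA => /(_ _)/le_trans; apply.
    by rewrite mulr_ge0// mulr_ge0// ltW.
  by rewrite -natrM.
apply: (@le_trans _ _ (\int[P]_p (4 * b * l * (gibbs u p + gibbs v p)))%R).
  apply: Int_le.
  - by apply/integ_norm/integB; exact: density_integ.
  - by apply/integZ/integD; exact: density_integ.
  - move=> p; have := half _ _ up vp uv p.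
    have := half _ _ vp up vu p.
    have := gibbs_gt0 p up; have := gibbs_gt0 p vp.
    move: (gibbs u p) (gibbs v p) => x y y0 x0 yx xy.
    have : (E - 1) * x <= 4 * b * l * x by rewrite ler_pM2r.
    have : (E - 1) * y <= 4 * b * l * y by rewrite ler_pM2r.
    have : 0 <= 4 * b * l by rewrite !mulr_ge0// ltW.
    rewrite ler_norml; nra.
rewrite IntZ; last by apply: integD; exact: density_integ.
rewrite IntD ?density_Int//; [|exact: density_integ..].
lra.
Qed.

(** * Mixtures of densities and almost minimizers *)

Definition mix t f h : T -> R := fun p => (1 - t) * f p + t * h p.

Lemma mix_density t f h : 0 <= t -> t <= 1 -> density f -> density h ->
  density (mix t f h).
Proof.
move=> t0 t1 fd hd; have fi := density_integ fd; have hi := density_integ hd.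
have mi := integD (integZ (1 - t) fi) (integZ t hi).
split; first exact: integ_measurable mi.
split=> [p|]; first by rewrite addr_ge0// mulr_ge0 ?subr_ge0 ?fd.2.1 ?hd.2.1.
rewrite [LHS](IntE mi) IntD; [|exact: integZ..].
by rewrite !IntZ// !density_Int// !mulr1 subrK.
Qed.

Lemma mix_entropy t f h : 0 < t -> t <= 1 -> density f -> density h ->
  (forall p, 0 < h p) -> finite_entropy f -> finite_entropy h ->
  finite_entropy (mix t f h) /\
  entropy (mix t f h) <= (1 - t) * entropy f + t * entropy h.
Proof.
move=> t0 t1 fd hd h0 fe he.
have md := mix_density (ltW t0) t1 fd hd.
have ci := integD (integZ (1 - t) fe) (integZ t he).
have cvx p : xlogx (mix t f h p) <= (1 - t) * xlogx (f p) + t * xlogx (h p).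
  by apply: xlogx_convex => //; exact: fd.2.1.
have me : finite_entropy (mix t f h).
  (* Convexity bounds the integrand from above and [x - 1 >= -1] bounds it from below, whence the
     dominating function. *)
  apply: (integ_le _ _ (integD (integ_norm ci) (integ_cst P 1))).
    exact: (measurableT_comp (@measurable_xlogx R) md.1).
  move=> p /=; have := cvx p; have := xlogx_ge_subr1 (md.2.1 p).
  have := md.2.1 p; have := ler_norm ((1 - t) * xlogx (f p) + t * xlogx (h p)).
  have := normr_ge0 ((1 - t) * xlogx (f p) + t * xlogx (h p)).
  by rewrite ler_norml; lra.
split => //.
rewrite -!IntZ// -IntD; [|exact: integZ..].
exact: Int_le.
Qed.

Lemma mix_interaction t f h : 0 <= t -> t <= 1 -> density f -> density h ->
  Q (mix t f h) (mix t f h) = (1 - t) ^+ 2 * Q f f + 2 * t * (1 - t) * Q f h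
    + t ^+ 2 * Q h h.
Proof.
move=> t0 t1 fd hd; have fi := density_integ fd; have hi := density_integ hd.
have md := mix_density t0 t1 fd hd.
have Ui g g' (gd : density g) (gd' : density g') :=
  Upot_integ gd (density_integ gd').
have UE p : U (mix t f h) p = (1 - t) * U f p + t * U h p.
  rewrite /Upot -!IntZ; [|exact: kernel_integ..].
  rewrite -IntD; [|exact/integZ/kernel_integ..].
  by apply: Int_eq => q; rewrite /mix; ring.
have -> : 2 * t * (1 - t) * Q f h = t * (1 - t) * Q f h + t * (1 - t) * Q h f.
  by rewrite /interaction (Upot_sym hd fd); ring.
rewrite /interaction -!IntZ; [|exact: Ui..].
rewrite -!IntD; [|by repeat first [exact/integZ/Ui | apply: integD]..].
by apply: Int_eq => p; rewrite UE /mix; ring.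
Qed.

(* Compare [f] with its mixture with [gibbs (U f)]. *)
Lemma almost_minimizer_relative_entropy m f t :
  (forall h, density h -> finite_entropy h -> m <= J h) ->
  density f -> finite_entropy f -> 0 < t -> t <= 1 -> J f <= m + t ^+ 2 ->
  entropy f + b * Q f f + ln (partition_fun (U f)) <= (1 + b * K) * t.
Proof.
move=> hm fd fe t0 t1 Jf; have up := Upot_potential fd.
have hd := gibbs_density up; have he := gibbs_finite_entropy up.
have [me ent] := mix_entropy t0 t1 fd hd (fun p => gibbs_gt0 p up) fe he.
have := hm _ (mix_density (ltW t0) t1 fd hd) me.
rewrite /free_energy (mix_interaction (ltW t0) t1 fd hd).
have Eh := entropy_gibbs up; rewrite -/(Q f (gibbs (U f))) in Eh.
have /andP[ff0 ffK] := interaction_bound fd fd.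
have /andP[fh0 fhK] := interaction_bound fd hd.
have /andP[hh0 hhK] := interaction_bound hd hd.
move: Jf; rewrite /free_energy.
move: ent; rewrite Eh.
set h := gibbs (U f).
move: (entropy (mix t f h)) (entropy f) (Q f f) (Q f h) (Q h h) (ln (partition_fun (U f)))
  ff0 ffK fh0 fhK hh0 hhK => em ef ff fh hh lz ff0 ffK fh0 fhK hh0 hhK ent Jf Jm.
(* After multiplication by [t], the left side is [J f] plus a quadratic remainder minus the
   convexity bound for the energy of the mixture. That bound is at least [m], so both parts are of
   order [t ^+ 2]. *)
rewrite -(ler_pM2l t0).
have sq : b / 2 * t ^+ 2 * (ff - 2 * fh + hh) <= b / 2 * t ^+ 2 * (2 * K).
  by rewrite ler_wpM2l ?mulr_ge0 ?(ltW t0) ?(ltW hb)//; lra.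
have -> : t * (ef + b * ff + lz) =
  (ef + b / 2 * ff) + b / 2 * t ^+ 2 * (ff - 2 * fh + hh) -
  ((1 - t) * ef + t * (- b * fh - lz) + b / 2 *
     ((1 - t) ^+ 2 * ff + 2 * t * (1 - t) * fh + t ^+ 2 * hh)) by field.
have -> : t * ((1 + b * K) * t) = t ^+ 2 + b / 2 * t ^+ 2 * (2 * K) by field.
lra.
Qed.

(** With [t = l ^+ 2] the relative entropy is at most [(1 + b * K) * l ^+ 2]; [L1_dist_gibbs] adds
    [2 * l ^+ 2], and dividing by [l] leaves a bound linear in [l]. Hence the tolerance [l ^+ 4]. *)
Lemma almost_minimizer_L1_dist m f l :
  (forall h, density h -> finite_entropy h -> m <= J h) ->
  density f -> finite_entropy f -> 0 < l -> l <= 2^-1 -> J f <= m + l ^+ 4 ->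
  (\int[P]_p `|f p - gibbs (U f) p|)%R <= (3 + b * K) * l.
Proof.
move=> hm fd fe l0 l2 Jf.
have := L1_dist_gibbs (Upot_potential fd) fd fe (ltW l0) l2.
have := @almost_minimizer_relative_entropy m f (l ^+ 2) hm fd fe.
rewrite exprn_gt0// exprn_ile1 ?(ltW l0)//; last lra.
rewrite -exprM => /(_ isT isT Jf); rewrite /interaction.
move: (\int[P]_p `|_|)%R => I h1 h2.
rewrite -(ler_pM2l l0); apply: le_trans h2 _.
have -> : l * ((3 + b * K) * l) = (1 + b * K) * l ^+ 2 + 2 * l ^+ 2 by ring.
lra.
Qed.

(* With [g = gibbs u] and [H f g >= 0] the relative entropy of [f], one has
   [J g - J f = - H f g - b / 2 * interaction (f - g) (f - g)]. *)
Lemma free_energy_gibbs_le u f : potential u -> U (gibbs u) =1 u ->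
  density f -> finite_entropy f ->
  J (gibbs u) <= J f + b * K * (\int[P]_p `|f p - gibbs u p|)%R.
Proof.
move=> up Uu fd fe; set g := gibbs u; set D := (\int[P]_p _)%R.
have gd : density g := gibbs_density up.
have fi := density_integ fd; have gi := density_integ gd.
have uE : u = U g by apply/funext => p; rewrite Uu.
have half0 : 0 <= 2^-1 :> R by rewrite invr_ge0.
(* At [l = 0] this is the nonnegativity of the relative entropy. *)
have := L1_dist_gibbs up fd fe (lexx 0) half0.
have := entropy_gibbs up; rewrite -/g [in X in X -> _]uE.
rewrite -/(Q g g) => Eg; rewrite mul0r expr0n/= mulr0 addr0.
rewrite [X in b * X](_ : _ = Q g f); last by rewrite /interaction -uE.
move=> Ef.
(* The quadratic term splits into two differences: the first pairs [U g] with [f - g], the second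
   pairs [U g - U f] with [f]. *)
have Qgg : Q g f - Q g g <= K * D.
  rewrite /interaction -IntB; [|exact: Upot_integ..].
  under eq_Rintegral do rewrite -mulrBr.
  apply: le_trans (ler_norm _) _.
  exact: Int_normM_le (Upot_measurable gd) (Upot_norm gd) (integB fi gi).
have Qgf : Q g f - Q f f <= K * D.
  rewrite /interaction -IntB; [|exact: Upot_integ..].
  rewrite -[leRHS]mulr1 -(density_Int fd) -IntZ//.
  apply: Int_le; [by apply: integB; exact: Upot_integ|exact: integZ|] => p.
  rewrite -mulrBl ler_wpM2r ?fd.2.1//; apply: le_trans (ler_norm _) _.
  by rewrite distrC; exact: Upot_dist.
rewrite /free_energy Eg.
have : b / 2 * (Q g f - Q g g) <= b / 2 * (K * D) by rewrite ler_wpM2l// divr_ge0// ltW.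
have : b / 2 * (Q g f - Q f f) <= b / 2 * (K * D) by rewrite ler_wpM2l// divr_ge0// ltW.
move: Ef; rewrite -uE; lra.
Qed.

(** * Existence and regularity of a minimizing Gibbs density *)

Lemma gibbs_minimizer : exists u, [/\ potential u, Lip L u, U (gibbs u) =1 u &
  forall f, density f -> (energy P k b (gibbs u) <= energy P k b f)%E].
Proof.
pose S := [set J f | f in [set f | density f /\ finite_entropy f]].
pose m := inf S.
(* The Gibbs density of the zero potential is the constant [1]; it shows that [S] is nonempty. *)
have p0 : potential (fun=> 0) by split => // p; rewrite lexx.
have S0 : S !=set0.
  exists (J (gibbs (fun=> 0))), (gibbs (fun=> 0)) => //.
  by split; [exact: gibbs_density|exact: gibbs_finite_entropy].
have Slb : lbound S 0 by move=> _ [f [fd fe] <-]; exact: free_energy_ge0.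
have Sinf : has_inf S by split => //; exists 0.
have hm f : density f -> finite_entropy f -> m <= J f.
  by move=> fd fe; apply: ge_inf; [exists 0|exists f].
pose V e := [set v | exists f,
  [/\ density f, finite_entropy f, J f <= m + e & v = U f]].
have [||||u [uL uK uV]] := Lip_cluster hM (V := V) (K := K) hL.
- move=> e e0; have [_ [f [fd fe] <-] Jf] := inf_adherent e0 Sinf.
  by exists (U f), f; split => //; exact: ltW.
- move=> e e' ee' _ [f [fd fe Jf ->]]; exists f; split => //.
  by rewrite (le_trans Jf)// lerD2l.
- by move=> e _ [f [fd _ _ ->]]; exact: Upot_Lip.
- by move=> e _ [f [fd _ _ ->]] p; exact: Upot_bound.
have up : potential u by split => //; exact: Lip_measurable uL.
have gd := gibbs_density up; have ge := gibbs_finite_entropy up.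
(* [3 + b * K] accounts for the distance from [f] to [gibbs (U f)], and [8 * b] for that from
   [gibbs (U f)] to [gibbs u]. *)
pose C := 3 + b * K + 8 * b.
(* The two bounds are the smallness conditions of [almost_minimizer_L1_dist] and of
   [gibbs_L1_dist]. *)
pose l0 := Order.min 2^-1 (4 * b)^-1.
have l00 : 0 < l0 by rewrite lt_min !invr_gt0 ltr0n mulr_gt0.
have near l : 0 < l -> l <= l0 -> exists f, [/\ density f, finite_entropy f,
    J f <= m + l, forall p, `|U f p - u p| <= l &
    (\int[P]_p `|f p - gibbs u p|)%R <= C * l].
  move=> l_gt0; rewrite le_min => /andP[l2 lb].
  have l4 : l ^+ 4 <= l.
    by rewrite -[leRHS]expr1; apply: ler_wiXn2l => //; [exact: ltW|lra].
  have l40 : 0 < l ^+ 4 by exact: exprn_gt0.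
  have [_ [f [fd fe Jf ->]] fu] := uV _ l40.
  have fu' p : `|U f p - u p| <= l by exact: le_trans (fu p) l4.
  exists f; split => //; first by rewrite (le_trans Jf)// lerD2l.
  have bl : 2 * b * l <= 2^-1.
    have := lb; rewrite -(ler_pM2l (mulr_gt0 (ltr0n _ 4) hb)) divff ?gt_eqF ?mulr_gt0//.
    lra.
  have h1 := almost_minimizer_L1_dist hm fd fe l_gt0 l2 Jf.
  have h2 := gibbs_L1_dist (Upot_potential fd) up (ltW l_gt0) bl fu'.
  have fi := density_integ fd; have gi := density_integ gd.
  have hi := density_integ (gibbs_density (Upot_potential fd)).
  apply: (@le_trans _ _ ((3 + b * K) * l + 8 * b * l)); last by rewrite /C; lra.
  apply: le_trans (lerD h1 h2).
  have i1 := integ_norm (integB fi hi); have i2 := integ_norm (integB hi gi).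
  rewrite -IntD//; apply: Int_le; [exact/integ_norm/integB|exact: integD|] => p.
  exact: ler_distD.
have Uu : U (gibbs u) =1 u.
  move=> p; apply/eqP; rewrite -subr_eq0 -normr_le0.
  (* Compare both sides with [U f] for a nearby almost minimizer [f]: [K * C] comes from the
     continuity of [U] in [L^1], and [1] from the uniform distance of [U f] to [u]. *)
  apply: (@small_multiple_le0 _ _ (K * C + 1) _ l00) => l l_gt0 ll0.
  have [f [fd _ _ fu D]] := near l l_gt0 ll0.
  apply: le_trans (ler_distD (U f p) _ _) _.
  rewrite mulrDl mul1r lerD// distrC -mulrA.
  apply: le_trans (Upot_dist p (density_integ fd) (density_integ gd)) _.
  by rewrite ler_wpM2l.
exists u; split => // f fd.
rewrite energy_free_energy//.
have [foo|] := ltP (energy P k b f) +oo%E; last by rewrite leye_eq => /eqP ->; rewrite leey.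
have fe := finite_energy_entropy fd foo.
rewrite energy_free_energy// lee_fin; apply: le_trans (hm _ fd fe).
(* An almost minimizer [h] has free energy at most [m + l], and [gibbs u] exceeds it by at most
   [b * K * C * l]. *)
rewrite -subr_le0; apply: (@small_multiple_le0 _ _ (1 + b * K * C) _ l00) => l l_gt0 ll0.
have [h [hd he Jh _ D]] := near l l_gt0 ll0.
have := free_energy_gibbs_le up Uu hd he.
have : b * K * (\int[P]_p `|h p - gibbs u p|)%R <= b * K * (C * l).
  by rewrite ler_wpM2l// mulr_ge0// ltW.
move: (b * K) (\int[P]_p _)%R => c x; lra.
Qed.

Lemma gibbs_Lip u : potential u -> Lip L u ->
  Lip ((partition_fun u)^-1 * (b * L)) (gibbs u).
Proof.
move=> up uL p q; rewrite /gibbs -mulrBr normrM ger0_norm; last first.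
  by rewrite invr_ge0 ltW// partition_gt0.
rewrite -mulrA ler_wpM2l ?invr_ge0 ?(ltW (partition_gt0 up))//.
have nn r : 0 <= b * u r.
  by rewrite mulr_ge0 ?(ltW hb)//; case/andP: (up.2 r).
rewrite !mulNr; apply: le_trans (expRN_Lipschitz (nn p) (nn q)) _.
by rewrite -mulrBr normrM (gtr0_norm hb) -mulrA ler_pM2l.
Qed.

End free_energy.

Theorem theorem1 (R : realType) (M : pmetricType R)
  (P : probability (borel_of M) R) (k : M -> M -> R) (b : R)
  (hM : compact [set: M])
  (hk0 : forall p q, 0 <= k p q)
  (hksym : forall p q, k p q = k q p)
  (hkLip : exists L : R, 0 < L /\
     forall p q s, `|k p s - k q s| <= L * mdist p q)
  (hb : 0 < b) :
  exists g : borel_of M -> R,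
    is_density P g /\
    (forall f, is_density P f -> (energy P k b g <= energy P k b f)%E) /\
    (forall p, 0 < g p) /\
    (exists C : R, forall p q, `|g p - g q| <= C * mdist p q) /\
    (forall p, g p = (Zpart P k b g)^-1 * expR (- b * Upot P k g p)).
Proof.
have [L [L0 kL]] := hkLip.
have hkL s : Lip L (k^~ s) by move=> p q; exact: kL.
have [K K0 kK] := kernel_bounded hM hk0 hksym L0 hkL.
have [u [up uL Uu gmin]] := gibbs_minimizer P hM hk0 hksym L0 hkL K0 kK hb.
exists (gibbs P b u); split; first exact: gibbs_density up.
split=> //; split; first by move=> p; exact: gibbs_gt0 up.
split; first by exists ((partition_fun P b u)^-1 * (b * L)); exact: (gibbs_Lip P hb up uL).
(* Once the potential of [gibbs u] is replaced by [u], the Onsager equation is the definition of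
   [gibbs]. *)
by rewrite /Zpart (funext Uu).
Qed.
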